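(* Let $\mathcal Q=\{Q_\theta:\theta\in\mathsf\Theta\}$ be a minimal exponential family on $\mathsf Z=\mathsf X\times\mathsf Y$, let $P$ be a distribution on $\mathsf Z$, let $Z^n=(Z_1,\dots,Z_n)$ be drawn i.i.d. from $P$, and let $\widehat Q=Q_{\hat\theta}$ be the projection of the empirical distribution of $Z^n$ to $\mathcal Q$ and $Q^*=Q_{\theta^*}$ the projection of $P$ to $\mathcal Q$. Let $\psi_{\widehat Q}:\mathsf X\to\mathsf A$ be the Bayes decision rule under $\widehat Q$ with respect to a loss function $\ell:\mathsf Y\times\mathsf A\to[0,1]$. Then the expected excess risk of using $\psi_{\widehat Q}$ under $P$ satisfies $$\mathbb E[\ell(Y,\psi_{\widehat Q}(X))]-H_\ell(P_{Y|X}|P_X)\le2d_{\rm TV}(P,Q^* )+\sqrt{2\|\mu\|\cdot\mathbb E\|\nabla A^*(\mu)-\nabla A^*(\hat\mu)\|+2\,\mathbb E\big|A(\nabla A^*(\mu))-A(\nabla A^*(\hat\mu))\big|},$$ where $(X,Y)\sim P$ is independent of $Z^n$, and the expectations are over $(Z^n,(X,Y))$ or over $\hat\mu$, with $P$ as the underlying distribution.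
   Context: Exponential family: for $\mathsf\Theta\subset\mathbb R^d$, a potential function $\varphi:\mathsf Z\to\mathbb R^d$, and a base density $\nu$ on $\mathsf Z$, $Q_\theta$ has density (with respect to $\nu$) $Q_\theta(z)=\exp\{\theta^\top\varphi(z)-A(\theta)\}$, with $A(\theta)=\log\int_{\mathsf Z}\exp\{\theta^\top\varphi(z)\}\nu(\mathrm dz)$. $\mathcal Q$ is minimal if $Q_\theta\ne Q_{\theta'}$ whenever $\theta\neq\theta'\in\mathsf\Theta$. Let $\mu=\mathbb E_P[\varphi(Z)]$ and $\hat\mu=\frac1n\sum_{i=1}^n\varphi(Z_i)$. The projection of $P$ to $\mathcal Q$ is $Q^*=\arg\min_{Q\in\mathcal Q}D(P\|Q)=Q_{\theta^*}$, where $\theta^*\in\mathsf\Theta$ satisfies $\nabla A(\theta^* )=\mathbb E_{Q_{\theta^*}}[\varphi(Z)]=\mu$. The projection of the empirical distribution is the maximum-likelihood solution $\widehat Q=\arg\max_{Q\in\mathcal Q}\sum_i\log Q(Z_i)=Q_{\hat\theta}$, where $\hat\theta\in\mathsf\Theta$ satisfies $\nabla A(\hat\theta)=\hat\mu$. Both projections are assumed to exist. $A^*(\mu)=\sup_{\theta\in\mathsf\Theta}(\mu^\top\theta-A(\theta))$ is the convex conjugate, defined for $\mu$ of the form $\mathbb E_{Q_\theta}[\varphi(Z)]$, $\theta\in\mathsf\Theta$; by convex duality for minimal families, $\theta^*=\nabla A^*(\mu)$ and $\hat\theta=\nabla A^*(\hat\mu)$ (i.e. $(\nabla A)^{-1}=\nabla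 A^*$), which may be taken as known. The generalized conditional entropy is $H_\ell(P_{Y|X}|P_X)=\inf_{\psi:\mathsf X\to\mathsf A}\mathbb E_P[\ell(Y,\psi(X))]$, and a Bayes decision rule under a joint distribution is a $\psi$ attaining this infimum; Bayes rules under $P$ and $\widehat Q$ are assumed to exist. $d_{\rm TV}(P,Q)=\frac12\int|P-Q|$; $\|\cdot\|$ is the Euclidean norm; $D$ is the KL divergence with natural logarithm. *)

(* Defs.v *)
From HB Require Import structures.
From mathcomp Require Import all_boot all_order all_algebra.
From mathcomp Require Import all_classical all_reals all_analysis.
Set Implicit Arguments.
Unset Strict Implicit.
Unset Printing Implicit Defensive.
Import Order.TTheory GRing.Theory Num.Theory.
Import numFieldNormedType.Exports.
Local Open Scope classical_set_scope.
Local Open Scope ring_scope.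

Section euclidean.
Context {R : realType} {d : nat}.
Implicit Types (u v x g : 'rV[R]_d) (f : 'rV[R]_d -> R).

Definition dotv u v : R := \sum_(i < d) u ord0 i * v ord0 i.

(* The library norm on matrices is the sup norm, hence this definition. *)
Definition enorm u : R := Num.sqrt (dotv u u).

Definition grad f x : 'rV[R]_d := \row_(i < d) 'D_(delta_mx ord0 i) f x.

Definition has_gradient f x g : Prop := differentiable f x /\ grad f x = g.

(* A*(m) = sup_(theta in Theta) (m^T theta - A(theta)); the supremum is taken in
   the extended reals, and the value is meaningful only where it is finite, in
   particular at every m = grad A theta with theta in Theta. *)
Definition convex_conjugate (Theta : set 'rV[R]_d) (A : 'rV[R]_d -> R)
    (m : 'rV[R]_d) : R :=
  fine (ereal_sup [set (dotv m theta - A theta)%:E | theta in Theta]).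

(* (grad A)^-1 = grad A^* on Theta. *)
Definition gradient_duality (Theta : set 'rV[R]_d) (A : 'rV[R]_d -> R) : Prop :=
  forall theta m, Theta theta -> has_gradient A theta m ->
    has_gradient (convex_conjugate Theta A) m theta.

End euclidean.

Section divergences.
Local Open Scope ereal_scope.
Local Open Scope charge_scope.
Context {d : measure_display} {T : measurableType d} {R : realType}.
Implicit Types P Q : probability T R.

Definition prob_diff P Q : {charge set T -> \bar R} :=
  cadd (charge_of_finite_measure P) (copp (charge_of_finite_measure Q)).

(* d_TV(P, Q) = |P - Q|(T) / 2, where |P - Q| is the variation of the signed
   measure P - Q (it does not depend on the Hahn decomposition chosen). *)
Definition dTV P Q : \bar R :=
  let pos := cid (Hahn_decomposition (prob_diff P Q)) in
  let neg := cid (projT2 pos) in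
  (2^-1)%:E * charge_variation (projT2 neg) [set: T].

Definition KL P Q : \bar R :=
  if `[< P `<< Q >]
  then \int[P]_z lne (('d (charge_of_finite_measure P) '/d Q) z)
  else +oo.

End divergences.

Section moments.
Context {dT : measure_display} {T : measurableType dT} {R : realType} {d : nat}.

Definition vmean (P : probability T R) (f : T -> 'rV[R]_d) : 'rV[R]_d :=
  \row_(i < d) fine 'E_P[fun z => f z ord0 i].

Definition vintegrable (P : probability T R) (f : T -> 'rV[R]_d) : Prop :=
  forall i, P.-integrable [set: T] (fun z => (f z ord0 i)%:E).

Definition empirical_mean (n : nat) (f : T -> 'rV[R]_d) (z : n.-tuple T) :
    'rV[R]_d :=
  n%:R^-1 *: \sum_(i < n) f (tnth z i).

End moments.

Section exponential_family.
Context {dZ : measure_display} {Z : measurableType dZ} {R : realType} {d : nat}.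
Variables (Theta : set 'rV[R]_d) (nu : {sigma_finite_measure set Z -> \bar R})
          (phi : Z -> 'rV[R]_d).

(* Outside the natural parameter space (infinite integral) the value is junk. *)
Definition log_partition (theta : 'rV[R]_d) : R :=
  ln (fine (\int[nu]_z (expR (dotv theta (phi z)))%:E)).

Definition expfam_density (theta : 'rV[R]_d) (z : Z) : R :=
  expR (dotv theta (phi z) - log_partition theta).

(* Since each Q theta is a probability, the second clause forces the partition
   integral to be positive and finite for theta in Theta; Q is unconstrained
   outside Theta. *)
Definition exponential_family (Q : 'rV[R]_d -> probability Z R) : Prop :=
  (forall i, measurable_fun [set: Z] (fun z => phi z ord0 i)) /\
  (forall theta, Theta theta -> forall B, measurable B ->
    (Q theta B = \int[nu]_(z in B) (expfam_density theta z)%:E)%E).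

Definition minimal_family (Q : 'rV[R]_d -> probability Z R) : Prop :=
  forall theta theta', Theta theta -> Theta theta' -> theta <> theta' ->
    ~ (forall B, measurable B -> Q theta B = Q theta' B).

Definition is_projection (Q : 'rV[R]_d -> probability Z R)
    (P : probability Z R) (thetas : 'rV[R]_d) : Prop :=
  [/\ Theta thetas,
      forall theta, Theta theta -> (KL P (Q thetas) <= KL P (Q theta))%E,
      has_gradient log_partition thetas (vmean P phi),
      vintegrable (Q thetas) phi &
      vmean (Q thetas) phi = vmean P phi].

Definition is_empirical_projection (n : nat) (z : n.-tuple Z)
    (thetah : 'rV[R]_d) : Prop :=
  [/\ Theta thetah,
      forall theta, Theta theta ->
        \sum_(i < n) ln (expfam_density theta (tnth z i)) <=
        \sum_(i < n) ln (expfam_density thetah (tnth z i)) &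
      has_gradient log_partition thetah (empirical_mean phi z)].

End exponential_family.

Section decision.
Context {dX dY dA : measure_display} {X : measurableType dX}
  {Y : measurableType dY} {Act : measurableType dA} {R : realType}.
Variable loss : Y -> Act -> R.

Definition risk (P : probability (X * Y)%type R) (psi : X -> Act) : \bar R :=
  'E_P[fun z => loss z.2 (psi z.1)].

Definition cond_entropy (P : probability (X * Y)%type R) : \bar R :=
  ereal_inf [set risk P psi | psi in [set psi | measurable_fun [set: X] psi]].

Definition is_bayes_rule (P : probability (X * Y)%type R) (psi : X -> Act) :
    Prop :=
  measurable_fun [set: X] psi /\ risk P psi = cond_entropy P.

End decision.

Section sampling.
Local Open Scope ereal_scope.
Context {dO dT : measure_display} {Omega : measurableType dO}
  {T : measurableType dT} {R : realType}.
Variable Pr : probability Omega R.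

Definition has_law (W : {RV Pr >-> T}) (P : probability T R) : Prop :=
  forall B, measurable B -> Pr (W @^-1` B) = P B.

(* Some of the sets B i may be [set: T], so the product rule for every
   subfamily is included. *)
Definition mutually_independent (n : nat) (Z : 'I_n -> {RV Pr >-> T}) : Prop :=
  forall B : 'I_n -> set T, (forall i, measurable (B i)) ->
    Pr (\bigcap_i (Z i @^-1` B i)) = \prod_(i < n) Pr (Z i @^-1` B i).

Definition iid (n : nat) (Z : 'I_n -> {RV Pr >-> T}) (P : probability T R) :
    Prop :=
  (forall i, has_law (Z i) P) /\ mutually_independent Z.

Definition sample (n : nat) (Z : 'I_n -> {RV Pr >-> T}) (w : Omega) :
    n.-tuple T :=
  [tuple Z i w | i < n].

Definition independent_of_sample (n : nat) (Z : 'I_n -> {RV Pr >-> T})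
    (W : {RV Pr >-> T}) : Prop :=
  forall (B : set (n.-tuple T)) (C : set T), measurable B -> measurable C ->
    Pr ((sample Z @^-1` B) `&` (W @^-1` C)) =
    Pr (sample Z @^-1` B) * Pr (W @^-1` C).

End sampling.

(* Main.v *)
(* Write Qs for the projection of P, Qh for that of the empirical distribution.
   For fixed Z^n, two comparisons of expectations of [0,1]-valued functions, one
   for each of the two rules, together with the optimality under Qh of its Bayes
   rule, bound the excess risk by 2 dTV(P, Qh), hence by
   2 dTV(P, Qs) + 2 dTV(Qs, Qh).  By Pinsker the last term is at most
   sqrt (2 D(Qs||Qh)), and since the mean of phi under Qs is mu,
   D(Qs||Qh) = (thetas - thetah).mu - A(thetas) + A(thetah), which
   Cauchy-Schwarz bounds by the integrand of the theorem.  Pinsker's inequality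
   and Jensen's inequality for the square root are handled together by working
   with sqrt (2 D) <= D / (2 c) + c for a deterministic c > 0: this bound is
   linear in D, so it can be integrated over Z^n, and c is optimised only at the
   end. *)
Require Import Defs.
From HB Require Import structures.
From mathcomp Require Import all_boot all_order all_algebra.
From mathcomp Require Import all_classical all_reals all_analysis.
From mathcomp Require Import measurable_realfun ring lra.
Import Order.TTheory GRing.Theory Num.Theory.
Import numFieldNormedType.Exports.
Set Implicit Arguments.
Unset Strict Implicit.
Unset Printing Implicit Defensive.
Local Open Scope classical_set_scope.
Local Open Scope ring_scope.

(** * A pointwise form of Pinsker's inequality *)

(* The left-hand side is [(5 t^2 - 4 t - 1) / (2 t^2 + 4 t)] in partial
   fractions, i.e. [3 (t - 1)^2 <= (2 t + 4) (t ln t - t + 1)] solved for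
   [ln t]; the difference of the two sides has derivative
   [(t - 1)^3 / (t^2 (t + 2)^2)]. *)
Lemma ln_ge_ratio (R : realType) (t : R) : 0 < t ->
  5 / 2 - 1 / 4 * t^-1 - 27 / 4 * (t + 2)^-1 <= ln t.
Proof.
move=> t0.
pose g (x : R) := ln x + 1 / 4 * x^-1 + 27 / 4 * (x + 2)^-1 : R.
pose dg (x : R) := (x - 1) ^+ 3 / (x ^+ 2 * (x + 2) ^+ 2).
have gdg (x : R) : 0 < x -> is_derive x 1 g (dg x).
  move=> x0; have x2 : x + 2 != 0 by rewrite gt_eqF// addr_gt0.
  have xn0 : x != 0 by rewrite gt_eqF.
  have ? := is_derive1_ln x0.
  have dV : is_derive x 1 (fun y : R => y^-1) (- x ^- 2 *: 1).
    exact: (@is_deriveV _ id).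
  have dV2 : is_derive x 1 (fun y : R => (y + 2)^-1) (- (x + 2) ^- 2 *: 1).
    apply: (@is_deriveV _ (fun y => y + 2)) => //.
    by apply: is_derive_eq; rewrite addr0.
  apply: is_derive_eq; rewrite /dg /GRing.scale/=.
  by field; rewrite x2 xn0.
have g1 : g 1 = 5 / 2 by rewrite /g ln1; field.
suff : g 1 <= g t by rewrite g1 /g; lra.
have cont (a b : R) : 0 < a -> {within `[a, b], continuous g}.
  move=> a0; apply: derivable_within_continuous => x.
  rewrite in_itv/= => /andP[ax _].
  by have [] := gdg _ (lt_le_trans a0 ax).
have dpos (x : R) : 0 < x -> 0 < (x ^+ 2 * (x + 2) ^+ 2)^-1.
  by move=> x0; rewrite invr_gt0 mulr_gt0// exprn_gt0// addr_gt0.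
(* [dg] has the sign of [x - 1], so [g] is minimal at 1; the mean value theorem is applied on each
   side of 1. *)
have [t1|/ltW t1] := leP 1 t.
  have [|c] := @MVT_segment _ g dg _ _ t1 _ (cont _ _ ltr01).
    move=> x; rewrite in_itv/= => /andP[x1 _].
    by apply: gdg; rewrite (lt_trans ltr01).
  rewrite in_itv/= => /andP[c1 _] gE.
  rewrite -subr_ge0 gE /dg mulr_ge0 ?subr_ge0// mulr_ge0 ?exprn_ge0 ?subr_ge0//.
  by rewrite ltW// dpos// (lt_le_trans ltr01).
have [|c] := @MVT_segment _ g dg _ _ t1 _ (cont _ _ t0).
  move=> x; rewrite in_itv/= => /andP[xt _].
  by apply: gdg; rewrite (lt_trans t0).
rewrite in_itv/= => /andP[ct c1] gE.
rewrite -subr_le0 gE /dg mulr_le0_ge0 ?subr_ge0//.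
rewrite mulr_le0_ge0 ?(ltW (dpos _ _))// ?(lt_le_trans t0)//.
by rewrite exprS mulr_le0_ge0 ?subr_le0// sqr_ge0.
Qed.

Lemma pinsker_pointwise (R : realType) (p q f c : R) :
  0 < p -> 0 < q -> 0 <= f <= 1 -> 0 < c ->
  f * (p - q) <=
  (p - q) / 2 + (p * ln (p / q) - p + q) / (4 * c) + c * (p + 2 * q) / 6.
Proof.
move=> p0 q0 /andP[f0 f1] c0.
have pos : f * (p - q) <= (p - q) / 2 + `|p - q| / 2.
  have [pq|pq] := leP 0 (p - q).
    by rewrite ger0_norm//; nra.
  by rewrite ltr0_norm//; nra.
have t0 : 0 < p / q by rewrite divr_gt0.
have := ln_ge_ratio t0; set L := ln (p / q) => HL.
(* Denominators are cleared by multiplying with [(2 * p + 4 * q) * p]. *)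
have {}HL : 3 * (p - q) ^+ 2 <= (2 * p + 4 * q) * (p * L - p + q).
  have w0 : 0 < (2 * p + 4 * q) * p by nra.
  have := ler_wpM2l (ltW w0) HL.
  have pqn : p + 2 * q != 0 by rewrite gt_eqF//; lra.
  have -> : (2 * p + 4 * q) * p *
     (5 / 2 - 1 / 4 * (p / q)^-1 - 27 / 4 * (p / q + 2)^-1) =
     3 * (p - q) ^+ 2 + (2 * p + 4 * q) * (p - q).
    by field; rewrite !gt_eqF// addr_gt0// mulr_gt0.
  by nra.
suff : `|p - q| <= (p * L - p + q) / (2 * c) + c * (p + 2 * q) / 3.
  move=> H; apply: (le_trans pos).
  have -> : (p * L - p + q) / (4 * c) = (p * L - p + q) / (2 * c) / 2.
    by field; rewrite gt_eqF.
  by lra.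
set K := p * L - p + q in HL *.
have w0 : 0 < p + 2 * q by lra.
have absq : `|p - q| ^+ 2 = (p - q) ^+ 2 by rewrite real_normK ?num_real.
set a := `|p - q| in absq *.
have -> : K / (2 * c) + c * (p + 2 * q) / 3 =
  (3 * K + 2 * (c ^+ 2 * (p + 2 * q))) / (6 * c) by field; rewrite gt_eqF.
rewrite ler_pdivlMr; last by rewrite mulr_gt0.
rewrite -(ler_pM2r w0).
(* Arithmetic-geometric mean with weight [c]: expanding gives [12 a c w <= 9 a^2 + 4 c^2 w^2] for
   [w = p + 2 q], and [HL] bounds [9 a^2] by [6 w K]. *)
have : 0 <= (3 * a - 2 * c * (p + 2 * q)) ^+ 2 by apply: sqr_ge0.
by nra.
Qed.

(** * Integration against a measure given by a density *)

Section density.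
Import HBNNSimple.

(** By monotone convergence both sides are limits along the same simple functions; linearity then
    reduces the claim to indicators of level sets, where it is the hypothesis on [m]. *)
Lemma ge0_integral_density d (T : measurableType d) (R : realType)
    (nu m : {measure set T -> \bar R}) (q : T -> R) (f : T -> \bar R) :
  measurable_fun [set: T] q -> (forall x, 0 <= q x) ->
  (forall B, measurable B -> m B = \int[nu]_(x in B) (q x)%:E)%E ->
  measurable_fun [set: T] f -> (forall x, 0 <= f x)%E ->
  (\int[m]_x f x = \int[nu]_x (f x * (q x)%:E))%E.
Proof.
move=> mq q0 mE mf f0.
have mqE : measurable_fun setT (EFin \o q) by exact/measurable_EFinP.
pose h := nnsfun_approx measurableT mf.
have -> : (\int[m]_x f x = limn (fun n => \int[m]_x (h n x)%:E))%E.
  rewrite -monotone_convergence//=.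
  - apply: eq_integral => x _; apply/esym/cvg_lim => //.
    exact: cvg_nnsfun_approx.
  - by move=> n; exact/measurable_EFinP.
  - by move=> n x _; rewrite lee_fin.
  - by move=> x _ a b ab; rewrite lee_fin; exact/lefP/nd_nnsfun_approx.
have -> : (\int[nu]_x (f x * (q x)%:E) =
    limn (fun n => \int[nu]_x ((h n x)%:E * (q x)%:E)))%E.
  rewrite -monotone_convergence//=.
  - apply: eq_integral => x _; apply/esym/cvg_lim => //.
    by apply: cvgeZr => //; exact: cvg_nnsfun_approx.
  - by move=> n; apply: emeasurable_funM => //; exact/measurable_EFinP.
  - by move=> n x _; rewrite mule_ge0 ?lee_fin.
  - move=> x _ a b ab; rewrite lee_wpmul2r ?lee_fin//.
    exact/lefP/nd_nnsfun_approx.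
congr (limn _); apply/funext => n.
have hE x : ((h n x)%:E =
    \sum_(y \in range (h n)) (y * \1_(h n @^-1` [set y]) x)%:E)%E.
  by rewrite [in LHS](fimfunE (h n)) -fsumEFin.
have mh y : measurable (h n @^-1` [set y]) by exact: measurable_funPTI.
under eq_integral do rewrite hE.
rewrite ge0_integral_fsum//; first last.
- by move=> y x _; exact: nnfun_muleindic_ge0.
- by move=> y; apply/measurable_EFinP; exact: measurable_funM.
under [RHS]eq_integral => x _.
  rewrite hE ge0_mule_fsuml; last by move=> y; exact: nnfun_muleindic_ge0.
  over.
rewrite ge0_integral_fsum//; first last.
- move=> y x _; apply: mule_ge0; last by rewrite lee_fin.
  exact: nnfun_muleindic_ge0.
- move=> y; apply: emeasurable_funM => //.
  by apply/measurable_EFinP; exact: measurable_funM.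
apply: eq_fsbigr => r; rewrite inE => -[t _ rE].
have r0 : 0 <= r by rewrite -rE.
under eq_integral do rewrite EFinM.
rewrite ge0_integralZl//; last exact/measurable_EFinP.
under [RHS]eq_integral do rewrite EFinM -muleA.
rewrite ge0_integralZl//; last 2 first.
- by apply: emeasurable_funM => //; exact/measurable_EFinP.
- by move=> x _; rewrite mule_ge0 ?lee_fin.
congr (_ * _)%E.
rewrite integral_indic// setIT mE// integral_mkcond; apply: eq_integral => x _.
by rewrite epatch_indic muleC.
Qed.

End density.

Section signed_density.
Context d (T : measurableType d) (R : realType).
Variables (nu m : {measure set T -> \bar R}) (q h : T -> R).
Hypotheses (mq : measurable_fun [set: T] q) (q0 : forall x, 0 <= q x).
Hypothesis mE :
  (forall B, measurable B -> m B = \int[nu]_(x in B) (q x)%:E)%E.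
Hypothesis ih : m.-integrable [set: T] (EFin \o h).

Let mh : measurable_fun [set: T] h.
Proof. exact/measurable_EFinP/(measurable_int _ ih). Qed.

Lemma integrable_density : nu.-integrable [set: T] (fun x => (h x * q x)%:E).
Proof.
apply/integrableP; split; first exact/measurable_EFinP/measurable_funM.
have /integrableP[_] := ih; rewrite (ge0_integral_density mq q0 mE)//.
  apply: le_lt_trans; rewrite le_eqVlt; apply/orP; left; apply/eqP.
  by apply: eq_integral => x _ /=; rewrite normrM EFinM (ger0_norm (q0 x)).
by apply/measurableT_comp => //; exact/measurable_EFinP.
Qed.

Lemma integral_density :
  (\int[m]_x (h x)%:E = \int[nu]_x (h x * q x)%:E)%E.
Proof.
have mhE : measurable_fun [set: T] (EFin \o h) by exact/measurable_EFinP.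
rewrite integralE [RHS]integralE.
rewrite !(ge0_integral_density mq q0 mE)//; last 2 first.
- exact: measurable_funeneg.
- exact: measurable_funepos.
(* As [q] is non-negative, multiplying by it commutes with taking positive and negative parts. *)
congr (_ - _)%E; apply: eq_integral => x _.
  by rewrite !funeposE EFinM maxeMl ?lee_fin// mul0e.
by rewrite !funenegE EFinM -mulNe maxeMl ?lee_fin// mul0e.
Qed.

End signed_density.

(** * Euclidean inner product and bounded integrands *)

Section dotv.
Context (R : realType) (d : nat).
Implicit Types u v w : 'rV[R]_d.

Lemma dotvBl u v w : dotv (u - v) w = dotv u w - dotv v w.
Proof. by rewrite /dotv -sumrB; apply: eq_bigr => i _; rewrite !mxE mulrBl. Qed.

Lemma dotvv_ge0 u : 0 <= dotv u u.
Proof. by apply: sumr_ge0 => i _; rewrite -expr2 sqr_ge0. Qed.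

Lemma enorm_ge0 u : 0 <= enorm u. Proof. exact: sqrtr_ge0. Qed.

(** Cauchy-Schwarz through Lagrange's identity: the double sum of squares below is twice the gap
    between [dotv u u * dotv v v] and [dotv u v ^+ 2]. *)
Lemma dotv_le_enorm u v : dotv u v <= enorm u * enorm v.
Proof.
rewrite /enorm -sqrtrM ?dotvv_ge0//.
apply: (le_trans (ler_norm _)); rewrite -sqrtr_sqr ler_sqrt; last first.
  by rewrite mulr_ge0 ?dotvv_ge0.
have : 0 <= \sum_i \sum_j (u ord0 i * v ord0 j - u ord0 j * v ord0 i) ^+ 2.
  by apply: sumr_ge0 => i _; apply: sumr_ge0 => j _; exact: sqr_ge0.
have -> : \sum_i \sum_j (u ord0 i * v ord0 j - u ord0 j * v ord0 i) ^+ 2 =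
    (dotv u u * dotv v v) *+ 2 - (dotv u v ^+ 2) *+ 2.
  have -> : dotv u u * dotv v v *+ 2 - dotv u v ^+ 2 *+ 2 =
     dotv u u * dotv v v + dotv v v * dotv u u
       - (dotv u v * dotv u v) *+ 2 by ring.
  rewrite /dotv !big_distrlr/= -big_split/= -sumrMnl -sumrB.
  apply: eq_bigr => i _; rewrite -big_split/= -sumrMnl -sumrB.
  by apply: eq_bigr => j _; ring.
by rewrite -mulrnBl pmulrn_lge0// subr_ge0.
Qed.

End dotv.

Lemma integrable_bounded01 d (T : measurableType d) (R : realType)
    (P : probability T R) (f : T -> R) :
  measurable_fun [set: T] f -> (forall x, 0 <= f x <= 1) ->
  P.-integrable [set: T] (EFin \o f).
Proof.
move=> mf f01; apply: measurable_bounded_integrable => //.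
  by rewrite [ltLHS]probability_setT ltry.
exists 1; split; first exact: num_real.
move=> M M1 x _; have /andP[f0 f1] := f01 x.
by rewrite /= ger0_norm// (le_trans f1)// ltW.
Qed.

(** * Pinsker's inequality inside an exponential family *)

Section exponential_family.
Context (dZ : measure_display) (Z : measurableType dZ) (R : realType) (d : nat).
Variables (Theta : set 'rV[R]_d) (nu : {sigma_finite_measure set Z -> \bar R})
          (phi : Z -> 'rV[R]_d) (Q : 'rV[R]_d -> probability Z R).
Hypothesis Q_expfam : exponential_family Theta nu phi Q.

Local Notation A := (log_partition nu phi).

Let mphi i : measurable_fun [set: Z] (fun z => phi z ord0 i).
Proof. by case: Q_expfam. Qed.

Lemma measurable_dotv_phi theta :
  measurable_fun [set: Z] (fun z => dotv theta (phi z)).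
Proof. by apply: measurable_sum => i; exact: measurable_funM. Qed.

Lemma measurable_expfam_density theta :
  measurable_fun [set: Z] (expfam_density nu phi theta).
Proof.
apply: measurableT_comp => //; apply: measurable_funB => //.
exact: measurable_dotv_phi.
Qed.

Lemma expfam_density_gt0 theta z : 0 < expfam_density nu phi theta z.
Proof. exact: expR_gt0. Qed.

Lemma integrable_dotv (m : probability Z R) v : vintegrable m phi ->
  m.-integrable [set: Z] (fun z => (dotv v (phi z))%:E).
Proof.
move=> iphi; under eq_fun do rewrite /dotv -sumEFin.
apply: integrable_sum => // i _.
under eq_fun do rewrite EFinM; exact: integrableZl.
Qed.

Lemma integral_dotv (m : probability Z R) v : vintegrable m phi ->
  (\int[m]_z (dotv v (phi z))%:E = (dotv v (vmean m phi))%:E)%E.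
Proof.
move=> iphi; under eq_integral do rewrite /dotv -sumEFin.
rewrite integral_sum//; last first.
  by move=> i; under eq_fun do rewrite EFinM; exact: integrableZl.
rewrite /dotv -sumEFin; apply: eq_bigr => i _.
under eq_integral do rewrite EFinM.
rewrite integralZl// mxE EFinM unlock fineK//.
exact: integrable_fin_num.
Qed.

Lemma integrable_expfam_density theta : Theta theta ->
  nu.-integrable [set: Z] (fun z => (expfam_density nu phi theta z)%:E).
Proof.
move=> th; apply/integrableP; split.
  exact/measurable_EFinP/measurable_expfam_density.
under eq_integral do rewrite gee0_abs ?lee_fin ?(ltW (expfam_density_gt0 _ _))//.
have [_ /(_ _ th _ measurableT) <-] := Q_expfam.
by rewrite probability_setT ltry.
Qed.

(* Pinsker's inequality [dTV <= sqrt (D / 2)] in the linearised form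
   [dTV <= D / (4 c) + c / 2] for every [c > 0], where [D] is the divergence
   of [Q theta] from [Q theta']. *)
Lemma expfam_pinsker theta theta' (f : Z -> R) (c : R) :
  Theta theta -> Theta theta' -> vintegrable (Q theta) phi ->
  measurable_fun [set: Z] f -> (forall z, 0 <= f z <= 1) -> 0 < c ->
  (\int[Q theta]_z (f z)%:E <= \int[Q theta']_z (f z)%:E +
   ((dotv (theta - theta') (vmean (Q theta) phi) - A theta + A theta') / (4 * c)
     + c / 2)%:E)%E.
Proof.
move=> th th' iphi mf f01 c0.
set D := dotv _ _ - _ + _.
pose p := expfam_density nu phi theta; pose q := expfam_density nu phi theta'.
have [_ QE] := Q_expfam.
have p0 z : 0 < p z := expfam_density_gt0 theta z.
have q0 z : 0 < q z := expfam_density_gt0 theta' z.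
have mp : measurable_fun [set: Z] p := measurable_expfam_density theta.
have mq : measurable_fun [set: Z] q := measurable_expfam_density theta'.
have ip : nu.-integrable [set: Z] (EFin \o p) := integrable_expfam_density th.
have iq : nu.-integrable [set: Z] (EFin \o q) := integrable_expfam_density th'.
have Qp : (forall B, measurable B -> Q theta B = \int[nu]_(z in B) (p z)%:E)%E.
  exact: QE.
have Qq : (forall B, measurable B -> Q theta' B = \int[nu]_(z in B) (q z)%:E)%E.
  exact: QE.
have lnp z : ln (p z) = dotv theta (phi z) - A theta by rewrite expRK.
have lnq z : ln (q z) = dotv theta' (phi z) - A theta' by rewrite expRK.
clearbody p q.
have p1 : (\int[nu]_z (p z)%:E = 1)%E by rewrite -Qp// probability_setT.
have q1 : (\int[nu]_z (q z)%:E = 1)%E by rewrite -Qq// probability_setT.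
(* The log-likelihood ratio [ln (p z / q z)]: it is affine in [phi], so its mean under [Q theta] is
   the explicit expression [D]. *)
pose h z := dotv (theta - theta') (phi z) + (A theta' - A theta).
have ihc : (Q theta).-integrable [set: Z] (fun=> (A theta' - A theta)%:E).
  exact: finite_measure_integrable_cst.
have ihd := integrable_dotv (theta - theta') iphi.
have ih : (Q theta).-integrable [set: Z] (EFin \o h).
  exact: (integrableD measurableT ihd ihc).
have hE : (\int[Q theta]_z (h z)%:E = D%:E)%E.
  under eq_integral do rewrite EFinD.
  rewrite integralD// integral_dotv// integral_cst//.
  rewrite [X in (_ + _ * X)%E]probability_setT mule1.
  by rewrite -EFinD /D addrA addrAC.
have hln z : h z = ln (p z / q z).
  rewrite ln_div ?posrE// lnp lnq /h dotvBl.
  by rewrite opprB addrACA [RHS]addrACA; congr +%R; rewrite addrC.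
have fp := integrable_bounded01 (Q theta) mf f01.
have fq := integrable_bounded01 (Q theta') mf f01.
have p0' z : 0 <= p z by exact: ltW.
have q0' z : 0 <= q z by exact: ltW.
rewrite (integral_density mp p0' Qp fp).
rewrite (integral_density mq q0' Qq fq).
have ifp := integrable_density mp p0' Qp fp.
have ifq := integrable_density mq q0' Qq fq.
have ihp := integrable_density mp p0' Qp ih.
have := integral_density mp p0' Qp ih; rewrite hE => hpE.
(* Coefficients of [p], [q] and [h * p] in the bound of [pinsker_pointwise]. Since [a + b = c / 2],
   the integral of that bound is [D / (4 * c) + c / 2]. *)
pose a := 2^-1 - (4 * c)^-1 + c / 6; pose b := - 2^-1 + (4 * c)^-1 + c / 3.
pose g := (4 * c)^-1.
have iap : nu.-integrable [set: Z] (fun z => a%:E * (p z)%:E)%E.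
  exact: integrableZl.
have ibq : nu.-integrable [set: Z] (fun z => b%:E * (q z)%:E)%E.
  exact: integrableZl.
have igh : nu.-integrable [set: Z] (fun z => g%:E * (h z * p z)%:E)%E.
  exact: integrableZl.
have -> : (D / (4 * c) + c / 2)%:E =
    (\int[nu]_z (a%:E * (p z)%:E + (b%:E * (q z)%:E + g%:E * (h z * p z)%:E)))%E.
  rewrite integralD//; last exact: integrableD.
  rewrite integralD// !integralZl// p1 q1 -hpE !mule1 -EFinM -!EFinD.
  by congr (_%:E); rewrite /a /b /g; field; rewrite gt_eqF.
rewrite -integralD//; last by apply: integrableD => //; exact: integrableD.
apply: le_integral => //.
  by apply: integrableD => //; apply: integrableD => //; exact: integrableD.
move=> z _; rewrite -!EFinM -!EFinD lee_fin.
have := pinsker_pointwise (p0 z) (q0 z) (f01 z) c0; rewrite -hln.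
have -> : (p z - q z) / 2 + (p z * h z - p z + q z) / (4 * c) +
    c * (p z + 2 * q z) / 6 = a * p z + (b * q z + g * (h z * p z)).
  by rewrite /a /b /g; field; rewrite gt_eqF.
by lra.
Qed.

End exponential_family.

(** * Total variation and expectations of bounded functions *)

Section total_variation.
Context d (T : measurableType d) (R : realType) (P Q : probability T R).

Lemma dTV_fin_num : dTV P Q \is a fin_num.
Proof.
rewrite /dTV; set pos := cid _; set neg := cid _.
by rewrite fin_numM// /charge_variation/= fin_numD !fin_num_measure.
Qed.

Lemma dTV_ge0 : (0 <= dTV P Q)%E.
Proof. by rewrite mule_ge0 ?lee_fin// adde_ge0. Qed.

(** [P] and [Q] have equal mass, so the positive and negative parts of [P - Q] do too, and [dTV P Q]
    is the mass of the positive part. That mass bounds the integral of [f <= 1] against the positive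
    part. *)
Lemma integral_le_dTV (f : T -> R) :
  measurable_fun [set: T] f -> (forall x, 0 <= f x <= 1) ->
  (\int[P]_x (f x)%:E <= \int[Q]_x (f x)%:E + dTV P Q)%E.
Proof.
move=> mf f01; rewrite /dTV; set pos := cid _; set neg := cid _.
set H := projT2 neg.
have f0 x : (0 <= (f x)%:E)%E by rewrite lee_fin; case/andP: (f01 x).
have mfE : measurable_fun [set: T] (EFin \o f) by exact/measurable_EFinP.
(* The Jordan decomposition of [P - Q] is rearranged into an equality of sums of measures, which can
   be integrated without subtraction. *)
have PQ B : measurable B ->
    (P B + jordan_neg H B = Q B + jordan_pos H B)%E.
  move=> mB.
  have : (P B - Q B = jordan_pos H B - jordan_neg H B)%E.
    rewrite -[LHS]/(prob_diff P Q B) (jordan_decomp H mB).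
    by rewrite /cadd/= /cscale EFinN mulN1e.
  have Pf : P B \is a fin_num by exact: fin_num_measure.
  have Qf : Q B \is a fin_num by exact: fin_num_measure.
  have : jordan_pos H B \is a fin_num by exact: fin_num_measure.
  have : jordan_neg H B \is a fin_num by exact: fin_num_measure.
  case: (jordan_neg H B) => // n _; case: (jordan_pos H B) => // p _.
  case: (P B) Pf => // x _; case: (Q B) Qf => // y _.
  by rewrite -!EFinB -!EFinD => -[E]; congr (_%:E); lra.
have posneg : jordan_pos H setT = jordan_neg H setT.
  have := PQ _ measurableT; rewrite !probability_setT.
  have : jordan_pos H setT \is a fin_num by exact: fin_num_measure.
  have : jordan_neg H setT \is a fin_num by exact: fin_num_measure.
  case: (jordan_neg H setT) => // y _; case: (jordan_pos H setT) => // z _.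
  by rewrite -!EFinD => -[E]; congr (_%:E); lra.
have intPQ : (\int[P]_x (f x)%:E + \int[jordan_neg H]_x (f x)%:E =
              \int[Q]_x (f x)%:E + \int[jordan_pos H]_x (f x)%:E)%E.
  rewrite -!ge0_integral_measure_add//; apply: eq_measure_integral => B mB _.
  transitivity (P B + jordan_neg H B)%E; first exact: measure_addE.
  by rewrite PQ//; apply/esym; exact: measure_addE.
apply: (@le_trans _ _ (\int[P]_x (f x)%:E + \int[jordan_neg H]_x (f x)%:E)%E).
  by rewrite leeDl// integral_ge0.
rewrite intPQ leeD2l//.
rewrite /charge_variation/= -posneg.
have -> : ((2^-1)%:E * (jordan_pos H setT + jordan_pos H setT))%E =
    jordan_pos H setT.
  have : jordan_pos H setT \is a fin_num by exact: fin_num_measure.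
  case: (jordan_pos H setT) => // x _; rewrite -EFinD -EFinM.
  by congr (_%:E); lra.
apply: (@le_trans _ _ (\int[jordan_pos H]_x (cst 1%E x))%E).
  apply: ge0_le_integral => // x _; rewrite lee_fin.
  by case/andP: (f01 x).
by rewrite integral_cst// mul1e.
Qed.

End total_variation.

(** * Independence, measurability and the optimisation over [c] *)

(** Independence makes the law of [(S, W)] agree with the product of the law of [S] and [P] on
    rectangles, hence everywhere; Tonelli's theorem then freezes the first component. *)
Lemma ge0_integral_indep d d1 d2 (Om : measurableType d)
    (T1 : measurableType d1) (T2 : measurableType d2) (R : realType)
    (Pr : probability Om R) (S : {mfun Om >-> T1}) (W : {mfun Om >-> T2})
    (P : probability T2 R) (L : T1 * T2 -> \bar R) :
  (forall B C, measurable B -> measurable C ->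
    Pr ((S @^-1` B) `&` (W @^-1` C)) = Pr (S @^-1` B) * Pr (W @^-1` C))%E ->
  (forall C, measurable C -> Pr (W @^-1` C) = P C) ->
  measurable_fun [set: T1 * T2] L -> (forall x, 0 <= L x)%E ->
  (\int[Pr]_w L (S w, W w) = \int[Pr]_w \int[P]_z L (S w, z))%E.
Proof.
move=> indep law mL L0.
have mSW : measurable_fun [set: Om] (fun w => (S w, W w)).
  exact: measurable_fun_pair.
pose mSW' := isMeasurableFun.Build _ _ _ _ _ mSW.
pose SW : {mfun Om >-> (T1 * T2)%type} := HB.pack (fun w => (S w, W w)) mSW'.
transitivity (\int[distribution Pr SW]_x L x)%E.
  by rewrite ge0_integral_pushforward.
transitivity (\int[(distribution Pr S \x P)%E]_x L x)%E.
  apply: eq_measure_integral => B mB _; apply/esym.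
  apply: product_measure_unique => // B1 B2 mB1 mB2.
  by rewrite /distribution/= /pushforward -law// -indep.
rewrite fubini_tonelli1// ge0_integral_pushforward//.
- exact: measurable_fun_fubini_tonelli_F.
- by move=> s _; exact: integral_ge0.
Qed.

(* Stated for arbitrary [f] because the gradient of the conjugate at the
   empirical mean is only a.e. equal to a measurable function; the integral is
   a supremum over simple functions, so this direction survives. *)
Lemma ae_eq_integral_le d (T : measurableType d) (R : realType)
    (mu : {measure set T -> \bar R}) (f g : T -> \bar R) :
  measurable_fun [set: T] g -> (forall x, 0 <= g x)%E ->
  (forall x, 0 <= f x)%E -> {ae mu, forall x, f x = g x} ->
  (\int[mu]_x g x <= \int[mu]_x f x)%E.
Proof.
move=> mg g0 f0 [N [mN muN fgN]].
rewrite (ge0_negligible_integral mN)// integral_mkcond.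
rewrite ge0_integralTE; last by move=> x; exact: erestrict_ge0.
rewrite ge0_integralTE//.
apply: ge_ereal_sup => _ [h hg <-]; apply: ereal_sup_ubound; exists h => //= x.
apply: (le_trans (hg x)); rewrite patchE; case: ifPn => // /set_mem[_ Nx].
by have -> : f x = g x by apply: contrapT => /(fgN x)/Nx.
Qed.

(** The partition integral is a partial integral of a jointly measurable non-negative function, so
    Tonelli's theorem gives its measurability in the parameter. *)
Lemma measurable_log_partition_comp dT dZ (T : measurableType dT)
    (Z : measurableType dZ) (R : realType) (d : nat)
    (nu : {sigma_finite_measure set Z -> \bar R}) (phi : Z -> 'rV[R]_d)
    (t : T -> 'rV[R]_d) :
  (forall i, measurable_fun [set: Z] (fun z => phi z ord0 i)) ->
  (forall i, measurable_fun [set: T] (fun x => t x ord0 i)) ->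
  measurable_fun [set: T] (fun x => log_partition nu phi (t x)).
Proof.
move=> mphi mt; apply: measurableT_comp; first exact: measurable_ln.
apply: measurableT_comp; first exact: fine_measurable.
pose F (x : T * Z) : \bar R := (expR (dotv (t x.1) (phi x.2)))%:E.
apply: (@measurable_fun_fubini_tonelli_F _ _ _ _ _ nu F).
  apply/measurable_EFinP; apply: measurableT_comp => //.
  apply: measurable_sum => i; apply: measurable_funM.
    exact: (measurableT_comp (mt i) measurable_fst).
  exact: (measurableT_comp (mphi i) measurable_snd).
by move=> x; rewrite lee_fin expR_ge0.
Qed.

Lemma measurable_enorm_comp dT (T : measurableType dT) (R : realType) (d : nat)
    (t : T -> 'rV[R]_d) :
  (forall i, measurable_fun [set: T] (fun x => t x ord0 i)) ->
  measurable_fun [set: T] (fun x => enorm (t x)).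
Proof.
move=> mt; apply: measurableT_comp.
  exact: (continuous_measurable_fun (@sqrt_continuous R)).
by apply: measurable_sum => i; exact: measurable_funM.
Qed.

(** The assumed bound is applied to [1 - f], which again takes values in [0,1]. *)
Lemma integral_le_sym d (T : measurableType d) (R : realType)
    (P Q : probability T R) (K : R) :
  (forall f : T -> R, measurable_fun [set: T] f -> (forall x, 0 <= f x <= 1) ->
    (\int[P]_x (f x)%:E <= \int[Q]_x (f x)%:E + K%:E)%E) ->
  forall f : T -> R, measurable_fun [set: T] f -> (forall x, 0 <= f x <= 1) ->
    (\int[Q]_x (f x)%:E <= \int[P]_x (f x)%:E + K%:E)%E.
Proof.
move=> PQ f mf f01.
have compl (m : probability T R) :
    (\int[m]_x (1 - f x)%:E = 1 - \int[m]_x (f x)%:E)%E.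
  under eq_integral do rewrite EFinB.
  rewrite integralB//; last exact: integrable_bounded01.
    by rewrite integral_cst// [X in (_ * X - _)%E]probability_setT mule1.
  exact: finite_measure_integrable_cst.
have := PQ (fun x => 1 - f x); rewrite !compl.
have fin (m : probability T R) : (\int[m]_x (f x)%:E)%E \is a fin_num.
  by apply: integrable_fin_num => //; exact: integrable_bounded01.
move: (fin P) (fin Q); case: (\int[P]_x _)%E => // a _.
case: (\int[Q]_x _)%E => // b _.
have H1 : measurable_fun [set: T] (fun x => 1 - f x) by exact: measurable_funB.
have H2 x : 0 <= 1 - f x <= 1.
  by have /andP[? ?] := f01 x; apply/andP; split; lra.
by move=> /(_ H1 H2); rewrite -!EFinB -!EFinD !lee_fin; lra.
Qed.

(** For finite positive [I], the minimum over [c] of [I / (2 * c) + c] is [sqrt (2 * I)]. For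
    infinite [I] the conclusion is trivial. *)
Lemma le_poweR_half (R : realType) (x : R) (I : \bar R) : (0 <= I)%E ->
  (forall c : R, 0 < c -> (x%:E <= ((2 * c)^-1)%:E * I + c%:E)%E) ->
  (x%:E <= (2%:E * I) `^ 2^-1)%E.
Proof.
case: I => [i| |//]; last first.
  by move=> _ _; rewrite gt0_muley ?lte_fin// poweRyr ?leey// invr_eq0.
rewrite lee_fin => i0 H; rewrite -EFinM poweR_EFin lee_fin.
rewrite powR12_sqrt; last by rewrite mulr_ge0.
have : Num.sqrt (2 * i) ^+ 2 = 2 * i by rewrite sqr_sqrtr// mulr_ge0.
have := sqrtr_ge0 (2 * i); set s := Num.sqrt _.
rewrite le_eqVlt => /orP[/eqP <-|s0] si.
  (* Here [I = 0] and no [c] attains the infimum; if [x] were positive, [c = x / 2] would give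
     [x <= x / 2]. *)
  rewrite leNgt; apply/negP => x0.
  have := H (x / 2); rewrite divr_gt0// => /(_ isT).
  have -> : i = 0 by move: si; rewrite expr0n/=; lra.
  by rewrite mule0 add0e lee_fin; lra.
(* The minimiser is [c = s / 2], at which both terms equal [s / 2]. *)
have := H (s / 2); rewrite divr_gt0// => /(_ isT).
rewrite -EFinM -EFinD lee_fin.
have -> : i = s ^+ 2 / 2 by lra.
suff -> : (2 * (s / 2))^-1 * (s ^+ 2 / 2) + s / 2 = s by [].
by field; rewrite gt_eqF.
Qed.

(** * Excess risk for a fixed parameter estimate *)

Section excess_risk.
Context (R : realType) (dX dY dA : measure_display)
  (X : measurableType dX) (Y : measurableType dY) (Act : measurableType dA)
  (loss : Y -> Act -> R).
Hypothesis loss_meas :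
  measurable_fun [set: (Y * Act)%type] (fun p => loss p.1 p.2).
Hypothesis loss01 : forall y a, 0 <= loss y a <= 1.

Lemma measurable_loss d (T : measurableType d) (y : T -> Y) (a : T -> Act) :
  measurable_fun [set: T] y -> measurable_fun [set: T] a ->
  measurable_fun [set: T] (fun x => loss (y x) (a x)).
Proof.
move=> my ma.
exact: (measurableT_comp loss_meas (measurable_fun_pair my ma)).
Qed.

Lemma measurable_loss_rule (psi : X -> Act) : measurable_fun [set: X] psi ->
  measurable_fun [set: (X * Y)%type] (fun z => loss z.2 (psi z.1)).
Proof.
move=> mpsi; apply: measurable_loss => //.
exact: (measurableT_comp mpsi measurable_fst).
Qed.

Lemma risk_fin_num (P : probability (X * Y)%type R) (psi : X -> Act) :
  measurable_fun [set: X] psi -> risk loss P psi \is a fin_num.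
Proof.
move=> mpsi; rewrite /risk unlock; apply: integrable_fin_num => //.
by apply: integrable_bounded01 => //; exact: measurable_loss_rule.
Qed.

Lemma cond_entropy_le (P : probability (X * Y)%type R) (psi : X -> Act) :
  measurable_fun [set: X] psi -> (cond_entropy loss P <= risk loss P psi)%E.
Proof. by move=> mpsi; apply: ereal_inf_lbound; exists psi. Qed.

(** The risk of [psi'] is carried from [P] to [Q theta] to [Q theta'], replaced there by that of
    [psi], and carried back. Each crossing between [P] and [Q theta] costs [dTV], each one between
    [Q theta] and [Q theta'] costs [D / (4 * c) + c / 2], and each is made twice. *)
Lemma excess_risk_le (d : nat) (Theta : set 'rV[R]_d)
    (nu : {sigma_finite_measure set (X * Y)%type -> \bar R})
    (phi : (X * Y)%type -> 'rV[R]_d)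
    (Q : 'rV[R]_d -> probability (X * Y)%type R)
    (P : probability (X * Y)%type R) (theta theta' : 'rV[R]_d)
    (psi psi' : X -> Act) (c : R) :
  exponential_family Theta nu phi Q -> Theta theta -> Theta theta' ->
  vintegrable (Q theta) phi -> measurable_fun [set: X] psi ->
  is_bayes_rule loss (Q theta') psi' -> 0 < c ->
  (risk loss P psi' <= risk loss P psi + 2%:E * dTV P (Q theta) +
   ((dotv (theta - theta') (vmean (Q theta) phi) - log_partition nu phi theta
     + log_partition nu phi theta') / (2 * c) + c)%:E)%E.
Proof.
move=> QE th th' iphi mpsi [mpsi' bayes'] c0.
set D := dotv _ _ - _ + _.
have := @integral_le_dTV _ _ _ P (Q theta).
rewrite -(fineK (dTV_fin_num P (Q theta))).
set V := fine _ => PQ; have QP := integral_le_sym PQ.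
have QQ' (f : X * Y -> R) : measurable_fun [set: (X * Y)%type] f ->
    (forall x, 0 <= f x <= 1) -> (\int[Q theta]_x (f x)%:E <=
      \int[Q theta']_x (f x)%:E + (D / (4 * c) + c / 2)%:E)%E.
  by move=> mf f01; exact: (expfam_pinsker QE th th' iphi mf f01 c0).
have Q'Q := integral_le_sym QQ'.
have := cond_entropy_le (Q theta') mpsi; rewrite -bayes'.
have ml := measurable_loss_rule mpsi; have ml' := measurable_loss_rule mpsi'.
have l01 psi0 (z : X * Y) : 0 <= loss z.2 (psi0 z.1) <= 1 by exact: loss01.
have := QP _ ml (l01 psi); have := PQ _ ml' (l01 psi').
have := Q'Q _ ml (l01 psi); have := QQ' _ ml' (l01 psi').
have rE (m : probability (X * Y)%type R) psi0 :
  (\int[m]_z (loss z.2 (psi0 z.1))%:E)%E = risk loss m psi0.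
  by rewrite /risk unlock.
rewrite !rE.
rewrite -(fineK (risk_fin_num P mpsi)) -(fineK (risk_fin_num P mpsi')).
rewrite -(fineK (risk_fin_num (Q theta) mpsi)).
rewrite -(fineK (risk_fin_num (Q theta) mpsi')).
rewrite -(fineK (risk_fin_num (Q theta') mpsi)).
rewrite -(fineK (risk_fin_num (Q theta') mpsi')).
rewrite -!EFinM -!EFinD !lee_fin.
have -> : D / (2 * c) = 2 * (D / (4 * c)) by clearbody D; field; rewrite gt_eqF.
by lra.
Qed.

End excess_risk.

(** * Integration over the sample and the final bound *)

Theorem corollary14 (R : realType) (dX dY dA dO : measure_display)
  (X : measurableType dX) (Y : measurableType dY) (Act : measurableType dA)
  (Omega : measurableType dO) (d n : nat) (n_gt0 : (0 < n)%N)
  (Theta : set 'rV[R]_d) (nu : {sigma_finite_measure set (X * Y)%type -> \bar R})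
  (phi : (X * Y)%type -> 'rV[R]_d) (Q : 'rV[R]_d -> probability (X * Y)%type R)
  (Q_expfam : exponential_family Theta nu phi Q)
  (Q_minimal : minimal_family Theta Q)
  (duality : gradient_duality Theta (log_partition nu phi))
  (P : probability (X * Y)%type R) (phi_int : vintegrable P phi)
  (thetas : 'rV[R]_d)
  (thetas_proj : is_projection Theta nu phi Q P thetas)
  (Pr : probability Omega R) (Z : 'I_n -> {RV Pr >-> (X * Y)%type})
  (W : {RV Pr >-> (X * Y)%type})
  (Z_iid : iid Z P) (W_law : has_law W P) (ZW_indep : independent_of_sample Z W)
  (thetah : n.-tuple (X * Y)%type -> 'rV[R]_d)
  (thetah_meas : forall i, measurable_fun [set: n.-tuple (X * Y)%type]
     (fun z => thetah z ord0 i))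
  (thetah_proj : {ae Pr, forall w,
     is_empirical_projection Theta nu phi (sample Z w) (thetah (sample Z w))})
  (loss : Y -> Act -> R)
  (loss_meas : measurable_fun [set: (Y * Act)%type] (fun p => loss p.1 p.2))
  (loss01 : forall y a, 0 <= loss y a <= 1)
  (bayesP : exists psi : X -> Act, is_bayes_rule loss P psi)
  (psih : n.-tuple (X * Y)%type -> X -> Act)
  (psih_meas : measurable_fun [set: (n.-tuple (X * Y) * X)%type]
     (fun p => psih p.1 p.2))
  (psih_bayes : {ae Pr, forall w,
     is_bayes_rule loss (Q (thetah (sample Z w))) (psih (sample Z w))}) :
  let A := log_partition nu phi in
  let gradAs := grad (convex_conjugate Theta A) in
  let mu := vmean P phi in
  let muh := fun w => empirical_mean phi (sample Z w) in
  ('E_Pr[fun w => loss (W w).2 (psih (sample Z w) (W w).1)]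
     - cond_entropy loss P
   <= 2%:E * dTV P (Q thetas)
      + (2%:E * (enorm mu)%:E * 'E_Pr[fun w => enorm (gradAs mu - gradAs (muh w))%R]
         + 2%:E * 'E_Pr[fun w => `|A (gradAs mu) - A (gradAs (muh w))|%R])
        `^ (2^-1)%R)%E.
Proof.
cbv zeta; set A := log_partition nu phi.
set gradAs := grad (convex_conjugate Theta A); set mu := vmean P phi.
set muh := fun w : Omega => empirical_mean phi (sample Z w).
have [thS _ gmu iphiS meanS] := thetas_proj.
(* Duality turns the conjugate gradients into the parameters: surely at [mu], almost surely at the
   empirical mean. *)
have gs : gradAs mu = thetas by have [] := duality _ _ thS gmu.
have [mphi _] := Q_expfam.
have mS : measurable_fun [set: Omega] (sample Z).
  apply/measurable_fun_tnthP => i; apply: (eq_measurable_fun (Z i)) => //.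
  by move=> w _; rewrite /= tnth_mktuple.
pose mS' := isMeasurableFun.Build _ _ _ _ _ mS.
pose S : {mfun Omega >-> n.-tuple (X * Y)%type} := HB.pack (sample Z) mS'.
pose th w := thetah (sample Z w).
have mth i : measurable_fun [set: Omega] (fun w => th w ord0 i).
  exact: (measurableT_comp (thetah_meas i) mS).
have aeth : {ae Pr, forall w, gradAs (muh w) = th w}.
  by apply: filterS thetah_proj => w [thT _ gm]; have [] := duality _ _ thT gm.
(* Measurable versions of the two integrands of the statement, equal to them almost surely. *)
pose g1 w := enorm (thetas - th w); pose g2 w := `|A thetas - A (th w)|.
have mg1 : measurable_fun [set: Omega] g1.
  apply: measurable_enorm_comp => i.
  under eq_fun do rewrite !mxE.
  exact: measurable_funB.
have mg2 : measurable_fun [set: Omega] g2.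
  apply: measurableT_comp => //; apply: measurable_funB => //.
  exact: measurable_log_partition_comp.
have g1_ge0 w : 0 <= g1 w by exact: enorm_ge0.
have g2_ge0 w : 0 <= g2 w by exact: normr_ge0.
pose I1 := (\int[Pr]_w (g1 w)%:E)%E; pose I2 := (\int[Pr]_w (g2 w)%:E)%E.
have I1_ge0 : (0 <= I1)%E by apply: integral_ge0 => w _; rewrite lee_fin.
have I2_ge0 : (0 <= I2)%E by apply: integral_ge0 => w _; rewrite lee_fin.
have I1_le : (I1 <= 'E_Pr[fun w => enorm (gradAs mu - gradAs (muh w))%R])%E.
  rewrite unlock; apply: ae_eq_integral_le.
  - exact/measurable_EFinP.
  - by move=> w; rewrite lee_fin.
  - by move=> w; rewrite lee_fin enorm_ge0.
  - by apply: filterS aeth => w ->; rewrite gs.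
have I2_le : (I2 <= 'E_Pr[fun w => `|A (gradAs mu) - A (gradAs (muh w))|%R])%E.
  rewrite unlock; apply: ae_eq_integral_le.
  - exact/measurable_EFinP.
  - by move=> w; rewrite lee_fin.
  - by move=> w; rewrite lee_fin.
  - by apply: filterS aeth => w ->; rewrite gs.
pose I := ((enorm mu)%:E * I1 + I2)%E.
have I_ge0 : (0 <= I)%E by rewrite adde_ge0// mule_ge0// lee_fin enorm_ge0.
have IE : (\int[Pr]_w (enorm mu * g1 w + g2 w)%:E = I)%E.
  under eq_integral do rewrite EFinD EFinM.
  rewrite ge0_integralD//; last 4 first.
  - by move=> w _; rewrite mule_ge0 ?lee_fin ?enorm_ge0.
  - by apply: emeasurable_funM => //; exact/measurable_EFinP.
  - by move=> w _; rewrite lee_fin.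
  - exact/measurable_EFinP.
  rewrite ge0_integralZl_EFin ?enorm_ge0//; last exact/measurable_EFinP.
  by move=> w _; rewrite lee_fin.
have [psi [mpsi psi_bayes]] := bayesP.
rewrite -psi_bayes.
pose L (x : n.-tuple (X * Y)%type * (X * Y)) : \bar R :=
  (loss x.2.2 (psih x.1 x.2.1))%:E.
have mL : measurable_fun [set: n.-tuple (X * Y)%type * (X * Y)] L.
  apply/measurable_EFinP; apply: measurable_loss => //.
    exact: (measurableT_comp measurable_snd measurable_snd).
  have mfst : measurable_fun [set: n.-tuple (X * Y)%type * (X * Y)]
      (fun x => (x.1, x.2.1)).
    apply: measurable_fun_pair; first exact: measurable_fst.
    exact: (measurableT_comp measurable_fst measurable_snd).
  exact: (measurableT_comp psih_meas mfst).
have L_ge0 x : (0 <= L x)%E.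
  by rewrite lee_fin; case/andP: (loss01 x.2.2 (psih x.1 x.2.1)).
pose r w : \bar R := risk loss P (psih (sample Z w)).
have rE w : r w = (\int[P]_z L (sample Z w, z))%E by rewrite /r /risk unlock.
have mr : measurable_fun [set: Omega] r.
  apply: (eq_measurable_fun (fubini_F P L \o sample Z)).
    by move=> w _; rewrite rE.
  apply: measurableT_comp => //.
  exact: (@measurable_fun_fubini_tonelli_F _ _ _ _ _ P L).
have r_ge0 w : (0 <= r w)%E by rewrite rE; exact: integral_ge0.
(* The test point is independent of the sample, so the expected loss is the mean of the risk under
   [P] of the rule learnt from the sample. *)
have -> : ('E_Pr[fun w => loss (W w).2 (psih (sample Z w) (W w).1)] =
    \int[Pr]_w r w)%E.
  rewrite unlock (ge0_integral_indep (S := S) ZW_indep W_law mL L_ge0).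
  by apply: eq_integral => w _; rewrite rE.
set rP := risk loss P psi; set V := dTV P (Q thetas).
have rP_fin : rP \is a fin_num by exact: risk_fin_num.
have V_fin : V \is a fin_num by exact: dTV_fin_num.
have bound (c : R) : 0 < c ->
    (\int[Pr]_w r w <= rP + 2%:E * V + c%:E + ((2 * c)^-1)%:E * I)%E.
  move=> c0; pose k := (2 * c)^-1.
  have k0 : 0 <= k by rewrite invr_ge0 mulr_ge0// ltW.
  have K0 : (0 <= rP + 2%:E * V + c%:E)%E.
    rewrite !adde_ge0 ?lee_fin ?(ltW c0) ?mule_ge0 ?lee_fin ?dTV_ge0//.
    rewrite /rP /risk expectation_ge0// => z.
    by case/andP: (loss01 z.2 (psi z.1)).
  pose G w := (enorm mu * g1 w + g2 w)%:E.
  have G0 w : (0 <= G w)%E by rewrite lee_fin addr_ge0// mulr_ge0 ?enorm_ge0.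
  have mG : measurable_fun [set: Omega] G.
    apply/measurable_EFinP; apply: measurable_funD => //.
    exact: measurable_funM.
  have mkG : measurable_fun [set: Omega] (fun w => k%:E * G w)%E.
    exact: emeasurable_funM.
  have -> : (rP + 2%:E * V + c%:E + k%:E * I =
      \int[Pr]_w (rP + 2%:E * V + c%:E + k%:E * G w))%E.
    rewrite ge0_integralD//; last by move=> w _; rewrite mule_ge0// lee_fin.
    rewrite ge0_integralZl_EFin// IE integral_cst//.
    by rewrite [X in (_ * X + _)%E]probability_setT mule1.
  (* The comparison is only almost everywhere, as are the projection and Bayes properties. *)
  apply: ae_ge0_le_integral => //.
  - by move=> w _; rewrite adde_ge0// mule_ge0// lee_fin.
  - exact: emeasurable_funD.
  apply: filterS2 thetah_proj psih_bayes => w [thT _ _] bayes_w _.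
  have := excess_risk_le loss_meas loss01 P Q_expfam thS thT iphiS mpsi
    bayes_w c0.
  rewrite -/(r w) -/rP -/V meanS -/mu => /le_trans; apply.
  rewrite -!addeA leeD2l// leeD2l// -EFinM -EFinD lee_fin addrC lerD2l.
  rewrite mulrC ler_wpM2l//.
  (* Cauchy-Schwarz bounds the inner product with [mu]; the difference of log-partition values is at
     most its absolute value. *)
  rewrite -addrA lerD//.
    by rewrite (le_trans (dotv_le_enorm _ _))// mulrC.
  by rewrite /g2 -normrN opprB addrC ler_norm.
(* The risks are at most 1; finiteness permits the subtractions below. *)
have int_fin : (\int[Pr]_w r w)%E \is a fin_num.
  rewrite ge0_fin_numE; last exact: integral_ge0.
  apply: (@le_lt_trans _ _ (\int[Pr]_w (cst 1%E w))%E).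
    apply: ge0_le_integral => // w _; rewrite rE.
    apply: (@le_trans _ _ (\int[P]_z (cst 1%E z))%E).
      apply: ge0_le_integral => //.
        exact: (measurableT_comp mL (pair1_measurable _)).
      move=> z _; rewrite lee_fin.
      by case/andP: (loss01 z.2 (psih (sample Z w) z.1)).
    by rewrite integral_cst// [X in (_ * X)%E]probability_setT mule1.
  by rewrite integral_cst// [X in (_ * X)%E]probability_setT mule1 ltry.
(* Monotonicity of the square root passes from [I1] and [I2] to the expectations in the
   statement. *)
apply: (@le_trans _ _ (2%:E * V + (2%:E * I) `^ 2^-1)%E); last first.
  rewrite leeD2l// gt0_ler_poweR ?invr_ge0//.
  - by rewrite in_itv/= leey mule_ge0.
  - rewrite in_itv/= leey andbT adde_ge0// ?mule_ge0 ?lee_fin ?enorm_ge0//.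
      exact: le_trans I1_le.
    exact: le_trans I2_le.
  rewrite /I muleDr//; last first.
    by rewrite ge0_adde_def// inE mule_ge0// lee_fin enorm_ge0.
  rewrite -muleA leeD// lee_pmul// ?lee_wpmul2l ?mule_ge0 ?lee_fin ?enorm_ge0//.
move: int_fin rP_fin V_fin bound.
case: (\int[Pr]_w r w)%E => // e _; case: rP => // h _; case: V => // v _ bound.
(* Only now is [c] optimised; [I] may still be infinite. *)
rewrite -leeBlDl// -!EFinM -!EFinB; apply: le_poweR_half => // c c0.
have := bound c c0; rewrite -!EFinM -!EFinD -leeBlDl// -EFinB => /le_trans le.
rewrite addeC -leeBlDl// -EFinB; apply: le_trans (le _ (lexx _)).
by rewrite lee_fin; lra.
Qed.
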